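(* A cactus graph $G\in\mathcal{C}_{n,k}$ has the minimum possible value of the subpath number among all graphs in $\mathcal{C}_{n,k}$ (that is, $\mathrm{pn}(G)\le\mathrm{pn}(H)$ for all $H\in\mathcal{C}_{n,k}$) if and only if every cycle of $G$ is an end-triangle.
   Context: All graphs are finite, simple and undirected. The subpath number $\mathrm{pn}(G)$ of a graph $G$ is the total number of paths that are subgraphs of $G$ (undirected, so a path and its reversal are the same), including the trivial paths of length $0$ (single vertices). A cactus graph is a connected graph in which every edge lies in at most one cycle. $\mathcal{C}_{n,k}$ denotes the class of all cactus graphs on $n$ vertices with exactly $k$ cycles. A cycle of a cactus graph $G$ is an end-cycle if at most one of its vertices has degree greater than two in $G$. An end-triangle is an end-cycle which is a triangle (a cycle of length $3$). *)

(* Defs.v *)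
From mathcomp Require Import all_boot.

Set Implicit Arguments.
Unset Strict Implicit.
Unset Printing Implicit Defensive.

Record sgraph := SGraph {
  vertex :> finType;
  adj : rel vertex;
  adj_sym : symmetric adj;
  adj_irrefl : irreflexive adj }.

(* A vertex set together with a set of edges, an edge being the two-element
   set of its ends. *)
Definition subgraph (G : sgraph) : finType :=
  ({set G} * {set {set G}})%type.

Section Subgraphs.
Variable G : sgraph.
Implicit Types (s : seq G) (P C : subgraph G).

Definition edges : {set {set G}} :=
  [set [set p.1; p.2] | p : G * G & adj p.1 p.2].

Definition deg (x : G) : nat := #|[set y | adj x y]|.

Definition connected : bool :=
  (0 < #|G|) && [forall x : G, forall y : G, connect (@adj G) x y].

Definition path_subgraph s : subgraph G :=
  ([set x in s], [set:: [seq [set p.1; p.2] | p <- zip s (behead s)]]).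

Definition cycle_subgraph s : subgraph G :=
  ([set x in s], [set:: [seq [set x; next s x] | x <- s]]).

(* Paths and cycles are subgraphs, not vertex sequences, so that reversals
   (and, for cycles, rotations) are identified.  A duplicate-free sequence
   spanning P has size #|P.1|, so quantifying over tuples of that size loses
   nothing. *)
Definition is_path P : bool :=
  [exists t : #|P.1|.-tuple G,
    [&& 0 < size t, uniq t, sorted (@adj G) t & path_subgraph t == P]].

Definition is_cycle C : bool :=
  [exists t : #|C.1|.-tuple G,
    [&& 2 < size t, uniq t, cycle (@adj G) t & cycle_subgraph t == C]].

Definition pn : nat := #|[set P : subgraph G | is_path P]|.

Definition cycles : {set subgraph G} := [set C : subgraph G | is_cycle C].

Definition cactus : bool :=
  connected && [forall f in edges, #|[set C in cycles | f \in C.2]| <= 1].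

Definition cactus_class (n k : nat) : bool :=
  [&& cactus, #|G| == n & #|cycles| == k].

Definition end_cycle C : bool :=
  is_cycle C && (#|[set x in C.1 | 2 < deg x]| <= 1).

Definition end_triangle C : bool := end_cycle C && (#|C.2| == 3).

End Subgraphs.

Arguments edges : clear implicits.
Arguments connected : clear implicits.
Arguments pn : clear implicits.
Arguments cycles : clear implicits.
Arguments cactus : clear implicits.
Arguments cactus_class : clear implicits.

(* Main.v *)
Require Import Defs.
From mathcomp Require Import all_boot zify.

(** In a cactus [G], deleting the edges of a cycle [C] leaves one component for each vertex of [C]
    ([away_inj]).  So every vertex [x] has a well-defined gate on [C], the vertex of [C] that it
    remains connected to, and [C] separates [x] from [y] when their gates differ.  A path from [x]
    to [y] must go around each separating cycle one way or the other; these choices are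
    independent and determine the path, so that exactly [2 ^ c] paths join [x] to [y], where [c] is
    the number of cycles separating them ([card_paths_between]).

    Hence [2 * pn G = n + sum 2 ^ c], over all ordered pairs.  The elementary bound
    [2 * 2 ^ c >= 2 + c + c ^ 2] is an equality exactly when [c <= 2], and the sums of [c] and of
    [c ^ 2] count pairs of vertices separated by a cycle, respectively by two cycles (possibly
    equal).  A cycle [C] separates at least [4 * n - 6] ordered pairs: this is the number of pairs
    when all its vertices but one have nothing else attached to them and there are two of these,
    that is when [C] is an end-triangle, and it is larger otherwise ([leqif_separated_pairsxx]).
    Two distinct cycles both separate at least [8] ordered pairs, and exactly [8] when they are
    end-triangles.  When all cycles are end-triangles, a vertex is cut off by at most one cycle,
    so that [c <= 2].  Adding up,
      [(n + 2 * k) ^ 2 + n <= 2 * pn G + 10 * k],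
    with equality if and only if every cycle of [G] is an end-triangle ([leqif_pn]).

    It remains to see that the bound is attained in the class of [G].  Cycles of a cactus have,
    apart from their gates to a fixed vertex, pairwise disjoint vertex sets, so [n > 2 * k]
    ([cactus_size]); then [k] triangles and [n - 2 * k - 1] edges glued at a common vertex form a
    member of the class all of whose cycles are end-triangles. *)

Set Implicit Arguments.
Unset Strict Implicit.
Unset Printing Implicit Defensive.

(** * Edge sets of walks *)

Lemma set2_inj (T : finType) (a b x y : T) :
  [set a; b] = [set x; y] -> a = x /\ b = y \/ a = y /\ b = x.
Proof.
move=> e; have: a \in [set x; y] by rewrite -e set21.
have: b \in [set x; y] by rewrite -e set22.
have: x \in [set a; b] by rewrite e set21.
have: y \in [set a; b] by rewrite e set22.
rewrite !inE => /orP[]/eqP-> /orP[]/eqP-> /orP[]/eqP E1 /orP[]/eqP E2; subst; by auto.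
Qed.

Section Trails.
Variable G : sgraph.
Implicit Types (x y z u v w : G) (s p q : seq G) (P C : subgraph G).
Implicit Types (f : {set G}) (F : {set {set G}}).

Definition trail s : {set {set G}} := (path_subgraph s).2.

(** Working with edge sets instead of adjacency makes deleting edges a set difference:
    [link (edges G)] is adjacency, and [link (edges G :\: F)] adjacency in [G - F]. *)
Definition link F : rel G := [rel x y | [set x; y] \in F].

Lemma linkE F x y : link F x y = ([set x; y] \in F).
Proof. by []. Qed.

Lemma link_sym F : symmetric (link F).
Proof. by move=> x y; rewrite /link /= setUC. Qed.

Lemma connect_link_sym F : connect_sym (link F).
Proof. exact: sym_connect_sym (@link_sym F). Qed.

Lemma adjE : @adj G =2 link (edges G).
Proof.
move=> x y; apply/idP/imsetP => [xy | [[a b]]]; first by exists (x, y); rewrite ?inE.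
by rewrite inE /= => ab /set2_inj[] [-> ->] //; rewrite adj_sym.
Qed.

Lemma edge_neq x y : [set x; y] \in edges G -> x != y.
Proof. by move=> xy; apply: contraTneq xy => ->; rewrite -[_ \in _]adjE adj_irrefl. Qed.

Lemma trail0 : trail [::] = set0.
Proof. by apply/setP=> f; rewrite !inE. Qed.

Lemma trail1 x : trail [:: x] = set0.
Proof. by apply/setP=> f; rewrite !inE. Qed.

Lemma trail_cons x y s : trail (x :: y :: s) = [set x; y] |: trail (y :: s).
Proof. by apply/setP=> f; rewrite !inE. Qed.

Lemma trail_cat s w p : trail (s ++ w :: p) = trail (rcons s w) :|: trail (w :: p).
Proof.
elim: s => [|x [|y s] IH] /=; first by rewrite trail1 set0U.
  by rewrite !trail_cons trail1 setU0.
by rewrite !trail_cons -cat_cons IH /= setUA.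
Qed.

Lemma trail_rev s : trail (rev s) = trail s.
Proof.
elim: s => [|x [|y s] IH] //; rewrite rev_cons trail_cons -IH rev_cons.
by rewrite -!cats1 -catA /= trail_cat trail_cons trail1 setU0 cats1 setUC (setUC [set x]).
Qed.

Lemma trail_sub s f v : f \in trail s -> v \in f -> v \in s.
Proof.
elim: s => [|x [|y s] IH]; rewrite ?trail0 ?trail1 ?in_set0 //.
rewrite trail_cons => /setU1P[->|/IH{}IH vf]; last by rewrite in_cons IH ?orbT.
by rewrite !inE => /orP[->|->]; rewrite ?orbT.
Qed.

(** This is how a walk whose vertices avoid a cycle, except perhaps for its first one, is seen
    to avoid the edges of this cycle. *)
Lemma trail_meets z q f : f \in trail (z :: q) -> exists2 v, v \in f & v \in q.
Proof.
elim: q z => [|y q IH] z; rewrite ?trail1 ?in_set0 // trail_cons => /setU1P[->|/IH[v vf vq]].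
  by exists y; rewrite !inE eqxx ?orbT.
by exists v; rewrite // inE vq orbT.
Qed.

Lemma trail_meets_rcons s w f : f \in trail (rcons s w) -> exists2 v, v \in f & v \in s.
Proof.
rewrite -trail_rev rev_rcons => /trail_meets[v vf]; rewrite mem_rev; by exists v.
Qed.

Lemma path_link F x p : path (link F) x p = (trail (x :: p) \subset F).
Proof.
elim: p x => [|y p IH] x; first by rewrite trail1 sub0set.
by rewrite trail_cons subUset sub1set /= IH.
Qed.

Lemma path_adj x p : path (@adj G) x p = (trail (x :: p) \subset edges G).
Proof. by rewrite (eq_path adjE) path_link. Qed.

Lemma trail_connect F x p : trail (x :: p) \subset F -> connect (link F) x (last x p).
Proof. by rewrite -path_link => xp; apply/connectP; exists p. Qed.

Lemma connect_trail F x y : connect (link F) x y ->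
  exists p, [/\ trail (x :: p) \subset F, uniq (x :: p) & last x p = y].
Proof.
case/connectP=> p xp ->; case: (shortenP xp) => p' xp' Up' _.
by exists p'; rewrite -path_link.
Qed.

Lemma trail_head x y p : uniq (x :: y :: p) ->
  [set f in trail (x :: y :: p) | x \in f] = [set [set x; y]].
Proof.
move=> /andP[xNp _]; apply/setP=> f; rewrite in_set1 in_set trail_cons in_setU1.
case: eqP => [->|_] /=; first by rewrite !inE eqxx.
by apply/negP=> /andP[/trail_sub ft /ft]; rewrite (negPf xNp).
Qed.

Definition paths_between x y : {set subgraph G} :=
  [set P : subgraph G | [exists t : #|P.1|.-tuple G,
    [&& ohead t == Some x, last x t == y, uniq t, sorted (@adj G) t & path_subgraph t == P]]].

Lemma paths_betweenP x y P :
  reflect (exists p, [/\ trail (x :: p) \subset edges G, uniq (x :: p), last x p = y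
                       & P = path_subgraph (x :: p)])
          (P \in paths_between x y).
Proof.
rewrite inE; apply: (iffP existsP) => [[[s Hs]]|[p [xp Up lp ->]]].
  case: s Hs => [|x' p] //= Hs /and5P[/eqP[<-] /eqP <- Up xp /eqP<-].
  by exists p; rewrite -path_adj.
have Hs : size (x :: p) == #|(path_subgraph (x :: p)).1|.
  by rewrite /= cardsE (card_uniqP Up).
exists (Tuple Hs); rewrite /= !eqxx path_adj xp /= lp eqxx /=.
by move: Up => /= ->.
Qed.

Lemma is_pathP P : reflect (exists x y, P \in paths_between x y) (is_path P).
Proof.
apply: (iffP existsP) => [[[s Hs]]|[x [y /paths_betweenP[p [xp Up _ ->]]]]].
  case: s Hs => [|x p] //= Hs /and3P[Up xp /eqP<-].
  by exists x, (last x p); apply/paths_betweenP; exists p; rewrite -path_adj.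
have Hs : size (x :: p) == #|(path_subgraph (x :: p)).1|.
  by rewrite /= cardsE (card_uniqP Up).
by exists (Tuple Hs); rewrite /= path_adj xp eqxx /= andbT; move: Up => /= ->.
Qed.

Lemma paths_between_rev x y P : P \in paths_between x y -> P \in paths_between y x.
Proof.
case/paths_betweenP=> p [xp Up lp ->]; apply/paths_betweenP.
have E : rev (x :: p) = y :: behead (rev (x :: p)).
  by rewrite lastI rev_rcons lp.
exists (behead (rev (x :: p))); rewrite -E trail_rev rev_uniq; split=> //.
  by rewrite -[last _ _]/(last y (y :: _)) -E rev_cons last_rcons.
congr (_, _); last exact: esym (trail_rev (x :: p)).
by apply/setP=> v; rewrite !inE mem_rev inE.
Qed.

Lemma paths_between_refl x : paths_between x x = [set path_subgraph [:: x]].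
Proof.
apply/setP=> P; rewrite in_set1; apply/paths_betweenP/eqP => [[[|y p] [xp Up lp ->]]|->] //.
  by move: Up; rewrite /= -{1}lp /= mem_last.
by exists [::]; rewrite trail1 sub0set.
Qed.

Lemma trail_last x y s : uniq (rcons (rcons s y) x) ->
  [set f in trail (rcons (rcons s y) x) | x \in f] = [set [set y; x]].
Proof. by rewrite -trail_rev -rev_uniq !rev_rcons => /trail_head->; rewrite setUC. Qed.

(** The ends of a path can be read off the path as a subgraph, which is why paths need not be
    identified with vertex sequences up to reversal. *)
Lemma path_end x p v : 0 < size p -> uniq (x :: p) -> v \in x :: p ->
  (#|[set f in trail (x :: p) | v \in f]| == 1) = (v \in [:: x; last x p]).
Proof.
move=> p0 Up; rewrite in_cons => /predU1P[->|vp].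
  by case: p p0 Up => // a p _ Up; rewrite trail_head // cards1 eqxx inE eqxx.
case/splitPr: vp Up {p0} => s q Up.
have vs : v \notin x :: s.
  by move: Up; rewrite -cat_cons cat_uniq => /and3P[_] /= /norP[].
have vx : v != x by move: vs; rewrite in_cons => /norP[].
rewrite !in_cons (negPf vx) orbF last_cat /=.
rewrite -cat_cons trail_cat setIdE setIUl -!setIdE.
have {vs} : uniq (rcons (x :: s) v).
  by move: Up; rewrite -cat_cons -cat_rcons cat_uniq => /and3P[].
rewrite lastI => /trail_last->.
case: q Up => [|c q] Up /=.
  rewrite trail1 (_ : [set f in set0 | _] = set0) ?setU0 ?cards1 ?eqxx //.
  by apply/setP=> f; rewrite !inE.
have Uv : uniq (v :: c :: q) by move: Up; rewrite -cat_cons cat_uniq => /and3P[].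
rewrite trail_head //.
have -> : (v == last c q) = false.
  by apply/eqP=> e; move: Uv; rewrite /= -/([:: c & q]) {1}e mem_last.
apply/eqP=> /eqP/cards1P[f /setP E].
have := E [set last x s; v]; have := E [set v; c].
rewrite !inE !eqxx orbT => /esym/eqP <- /esym/eqP/set2_inj[] [e1 e2].
  by move: Uv; rewrite /= inE e2 eqxx.
by move: Up; rewrite -cat_cons cat_uniq => /and3P[_ /negP[]]; rewrite /= -e1 mem_last orbT.
Qed.

Lemma paths_between_ends x y x' y' P : P \in paths_between x y -> P \in paths_between x' y' ->
  (x', y') = (x, y) \/ (x', y') = (y, x).
Proof.
case/paths_betweenP=> p [xp Up lp EP] /paths_betweenP[p' [xp' Up' lp' EP']].
have sz : size p' = size p.
  have: #|P.1| = #|P.1| by []. rewrite {1}EP EP' /= !cardsE (card_uniqP Up) (card_uniqP Up').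
  by case.
have Pmem v : (v \in x :: p) = (v \in x' :: p').
  by have /setP/(_ v) : P.1 = P.1 by []; rewrite {1}EP EP' !in_set.
have Et : trail (x :: p) = trail (x' :: p') by rewrite /trail -EP -EP'.
have [p0|] := posnP (size p).
  rewrite p0 in sz; move/size0nil: p0 => p0; move/size0nil: sz => p0'.
  move: lp lp' Pmem; rewrite p0 p0' /= => <- <- /(_ x).
  by rewrite !inE eqxx => /esym/eqP->; left.
move=> p0; have p0' : 0 < size p' by rewrite sz.
have Ends v : (v \in [:: x; y]) = (v \in [:: x'; y']).
  rewrite -lp -lp'; have [vp|vp] := boolP (v \in x :: p).
    by rewrite -!path_end // -?Pmem // Et.
  transitivity false; [|symmetry]; apply: contraNF vp; last rewrite Pmem;
    by rewrite !inE => /orP[]/eqP->; rewrite -in_cons ?mem_head ?mem_last.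
have nx : x' != y'.
  case: p' p0' Up' lp' {sz Pmem EP' xp' Et} => //= a q _ /andP[aq _] <-.
  by apply: contraNneq aq => ->; rewrite mem_last.
have := Ends x'; have := Ends y'; rewrite !inE !eqxx !orbT.
by move=> /orP[]/eqP e1 /orP[]/eqP e2; rewrite e1 e2 ?eqxx in nx *; auto.
Qed.

(** A nontrivial path is counted from each of its two ends, a trivial one only once. *)
Lemma pn_paths_between :
  2 * pn G = #|G| + \sum_x \sum_y #|paths_between x y|.
Proof.
pose ends P := [set e : G * G | P \in paths_between e.1 e.2].
pose spots P := [set x | P \in paths_between x x].
have sw (T : finType) (g : T -> {set subgraph G}) (h : subgraph G -> {set T}) :
    (forall t P, (t \in h P) = (P \in g t)) ->
    (forall t P, P \in g t -> is_path P) ->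
    \sum_t #|g t| = \sum_(P | is_path P) #|h P|.
  move=> gh gp; under eq_bigr do rewrite -sum1_card.
  rewrite (exchange_big_dep (@is_path G)) /=; last by move=> t P _; apply: gp.
  by apply: eq_bigr => P _; rewrite -sum1_card; apply: eq_bigl => t; rewrite gh.
have jp x y P : P \in paths_between x y -> is_path P.
  by move=> xyP; apply/is_pathP; exists x, y.
have -> : #|G| = \sum_(P | is_path P) #|spots P|.
  rewrite -(sw G (fun x => paths_between x x)) => [||t P /jp//]; last by move=> x P; rewrite inE.
  by under eq_bigr do rewrite paths_between_refl cards1; rewrite sum1_card.
rewrite pair_big /=.
rewrite (sw _ (fun e : G * G => paths_between e.1 e.2) ends) => [||t P /jp//]; last first.
  by move=> e P; rewrite inE.
rewrite -big_split /= /pn -sum1_card big_distrr /=.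
under eq_bigl do rewrite inE; apply: eq_bigr => P /is_pathP[x [y xyP]].
have -> : ends P = [set (x, y); (y, x)].
  apply/setP=> -[x' y']; rewrite in_set in_set2 /=.
  apply/idP/idP => [/(paths_between_ends xyP)[]->|].
  - by rewrite eqxx.
  - by rewrite eqxx orbT.
  by case/orP=> /eqP[-> ->] //; apply: paths_between_rev.
rewrite cards2; have [exy|nxy] := eqVneq x y.
  rewrite -exy eqxx /= in xyP *; have -> : spots P = [set x]; last by rewrite cards1.
  apply/setP=> z; rewrite in_set in_set1; apply/idP/eqP => [zz|->//].
  by case: (paths_between_ends xyP zz) => -[].
rewrite xpair_eqE (negPf nxy) /= (_ : spots P = set0) ?cards0 //.
apply/setP=> z; rewrite in_set in_set0; apply/idP => zz.
by case: (paths_between_ends xyP zz) => -[e1 e2]; case/eqP: nxy; rewrite -e1 -e2.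
Qed.

End Trails.

(** * Cycles, and paths that part *)

Section Cycles.
Variable G : sgraph.
Implicit Types (x y z u v w : G) (s p q : seq G) (P C : subgraph G).
Implicit Types (f : {set G}) (F : {set {set G}}).

Lemma cycle_pairsE u s : uniq (u :: s) ->
  [seq [set x; next (u :: s) x] | x <- u :: s] =
  [seq [set e.1; e.2] | e <- zip (u :: rcons s u) (rcons s u)].
Proof.
move=> U; have -> : zip (u :: rcons s u) (rcons s u) = zip (u :: s) (rcons s u).
  have := @zip_cat _ _ (u :: s) [:: u] (rcons s u) [::].
  by rewrite !cats0 cats1 size_rcons => ->.
have sz : size (zip (u :: s) (rcons s u)) = size (u :: s).
  by rewrite size_zip size_rcons minnn.
apply: (@eq_from_nth _ set0) => [|i]; rewrite !size_map ?sz // => lti.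
have E : next (u :: s) (nth u (u :: s) i) = nth u s i by rewrite next_nth mem_nth // index_uniq.
rewrite (nth_map u) // (nth_map (u, u)) ?sz // nth_zip ?size_rcons // E.
rewrite [in RHS]/fst [in RHS]/snd nth_rcons.
by rewrite if_same; have [//|le] := ltnP i (size s); rewrite (nth_default u le).
Qed.

Lemma cycle_edgesE u s : uniq (u :: s) ->
  (cycle_subgraph (u :: s)).2 = trail (u :: rcons s u).
Proof. by move=> /cycle_pairsE/(congr1 (fun t => [set:: t])). Qed.

Lemma cycleP C : reflect
  (exists c, [/\ 2 < size c, uniq c, cycle (@adj G) c & C = cycle_subgraph c]) (is_cycle C).
Proof.
apply: (iffP existsP) => [[c /and4P[? ? ? /eqP?]]|[c [c2 Uc cc ->]]].
  by exists c.
have Hs : size c == #|(cycle_subgraph c).1| by rewrite /= cardsE (card_uniqP Uc).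
by exists (Tuple Hs); rewrite c2 Uc cc eqxx.
Qed.

Lemma cycle_at C u : is_cycle C -> u \in C.1 ->
  exists a s b, [/\ uniq [:: u, a & rcons s b], C.1 = [set x in [:: u, a & rcons s b]],
    C.2 = trail [:: u, a & rcons (rcons s b) u] & C.2 \subset edges G].
Proof.
case/cycleP=> c [c2 Uc cc ->]; rewrite inE => uc.
case: (rot_to uc) => i p E.
have sz : size p > 1 by move: c2; rewrite -(size_rot i) E.
case: p sz E => // a p; case/lastP: p => // s b _ E.
exists a, s, b; have U : uniq (rot i c) by rewrite rot_uniq.
have E1 : (cycle_subgraph c).1 = (cycle_subgraph (rot i c)).1.
  by apply/setP=> x; rewrite !inE mem_rot.
have E2 : (cycle_subgraph c).2 = (cycle_subgraph (rot i c)).2.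
  apply/setP=> f; rewrite !inE /=; apply/mapP/mapP => -[x xc ->]; exists x;
  by rewrite ?mem_rot ?next_rot // -(mem_rot i).
rewrite E1 E2 E in U *; split=> //; rewrite cycle_edgesE //=.
by rewrite -path_adj -[path _ _ _]/(cycle _ [:: u, a & rcons s b]) -E rot_cycle.
Qed.

Lemma cycle_gt2 C : is_cycle C -> 2 < #|C.1|.
Proof. by case/cycleP=> c [c2 U _ ->]; rewrite /= cardsE (card_uniqP U). Qed.

Lemma cycle_vertex C : is_cycle C -> exists u, u \in C.1.
Proof. by move=> /cycle_gt2/ltnW/ltnW/card_gt0P. Qed.

Lemma cycle_edges_sub C : is_cycle C -> C.2 \subset edges G.
Proof.
move=> cC; have [u uC] := cycle_vertex cC.
by case: (cycle_at cC uC) => a [s [b []]].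
Qed.

Lemma cycle_edge_ends C f v : is_cycle C -> f \in C.2 -> v \in f -> v \in C.1.
Proof.
move=> cC fC vf; have [u uC] := cycle_vertex cC.
case: (cycle_at cC uC) => a [s [b [_ E1 E2 _]]].
move: fC; rewrite E2 => /trail_sub/(_ vf); rewrite E1 inE -!rcons_cons mem_rcons in_cons.
by case/predU1P=> [->|//]; rewrite mem_head.
Qed.

Lemma edge_uniq f x y : f \in edges G -> f = [set x; y] -> x != y.
Proof. by move=> fE E; apply: edge_neq; rewrite -E. Qed.

(** A cycle is 2-regular, and either edge at [u] can be bypassed by going around the other way. *)
Lemma cycle_local C u : is_cycle C -> u \in C.1 ->
  exists a b, [/\ a != b, [set f in C.2 | u \in f] = [set [set u; a]; [set u; b]],
    connect (link (C.2 :\ [set u; a])) a u & connect (link (C.2 :\ [set u; b])) u b].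
Proof.
move=> cC uC; case: (cycle_at cC uC) => a [s [b [U _ E2 _]]].
have nab : a != b.
  by move: U; rewrite /= => /and3P[_ + _]; apply: contraNneq => ->; rewrite mem_rcons mem_head.
have [Uu Ua] := andP U.
have U' : uniq (rcons (rcons (a :: s) b) u) by rewrite rcons_uniq Uu.
have T1 : C.2 = [set u; a] |: trail (rcons (rcons (a :: s) b) u) by rewrite E2 trail_cons.
have T2 : C.2 = [set b; u] |: trail (u :: a :: rcons s b).
  by rewrite E2 -!rcons_cons -!cats1 -catA /= -cat_cons -cat_cons trail_cat trail_cons
    trail1 setU0 setUC cats1.
exists a, b; split=> //.
- rewrite T1 setIdE setIUl -setIdE -setIdE trail_last // [[set b; u]]setUC; congr (_ :|: _).
  by apply/setP=> f; rewrite !inE; case: eqP => // ->; rewrite !inE eqxx.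
- have -> : u = last a (rcons (rcons s b) u) by rewrite last_rcons.
  apply: trail_connect; rewrite last_rcons subsetD1 {1}T1 subsetUr /=.
  apply/negP=> H; have: [set u; a] \in [set f in trail (rcons (rcons (a :: s) b) u) | u \in f].
    by rewrite in_set H !inE eqxx.
  rewrite trail_last // in_set1 => /eqP/set2_inj[] [e1 e2].
    by move: Uu; rewrite e2 mem_head.
  by rewrite e2 eqxx in nab.
have -> : b = last u (a :: rcons s b) by rewrite /= last_rcons.
apply: trail_connect; rewrite /= last_rcons subsetD1 {1}T2 subsetUr /=.
apply/negP=> H; have: [set u; b] \in [set f in trail [:: u, a & rcons s b] | u \in f].
  by rewrite in_set H !inE eqxx.
rewrite trail_head // in_set1 => /eqP/set2_inj[] [e1 e2].
  by rewrite e2 eqxx in nab.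
by move: Uu; rewrite e1 mem_head.
Qed.

Lemma card_cycle_at C u : is_cycle C -> u \in C.1 -> #|[set f in C.2 | u \in f]| = 2.
Proof.
move=> cC uC; have [a [b [nab E _ _]]] := cycle_local cC uC.
rewrite E cards2; case: eqP => // /set2_inj[] [e1 e2]; first by rewrite e2 eqxx in nab.
by rewrite e2 e1 eqxx in nab.
Qed.

Lemma cycle_edge C : is_cycle C -> exists f, f \in C.2.
Proof.
move=> cC; have [u uC] := cycle_vertex cC.
have /card_gt0P[f] : 0 < #|[set f in C.2 | u \in f]| by rewrite card_cycle_at.
by rewrite inE => /andP[fC _]; exists f.
Qed.

Lemma card_edge f : f \in edges G -> #|f| = 2.
Proof.
by case/imsetP=> -[x y]; rewrite inE /= => xy ->; rewrite cards2 edge_neq // -[_ \in _]adjE.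
Qed.

(** Double counting of incidences: each vertex of a cycle is on two of its edges. *)
Lemma card_cycle C : is_cycle C -> #|C.2| = #|C.1|.
Proof.
move=> cC; apply/eqP; rewrite -(eqn_pmul2r (m := 2)) // -!sum_nat_const.
rewrite -(eq_bigr _ (fun u uC => card_cycle_at cC uC)).
have /subsetP CG := cycle_edges_sub cC.
rewrite -(eq_bigr _ (fun f fC => card_edge (CG f fC))).
under eq_bigr do rewrite -sum1_card.
under [X in _ == X]eq_bigr do rewrite -sum1_card.
rewrite (exchange_big_dep (mem C.1)) /=; last by move=> f u fC uf; apply: cycle_edge_ends uf.
by apply/eqP; apply: eq_bigr => u uC; apply: eq_bigl => f; rewrite inE.
Qed.

Lemma cycle_connect_avoid C f x y : is_cycle C -> f \in C.2 -> f = [set x; y] ->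
  connect (link (C.2 :\ f)) x y.
Proof.
move=> cC fC Ef; have xC : x \in C.1 by apply: (cycle_edge_ends cC fC); rewrite Ef set21.
have [a [b [nab E ax xb]]] := cycle_local cC xC.
have nxy : x != y by apply: edge_uniq Ef; apply: (subsetP (cycle_edges_sub cC)).
have: f \in [set f in C.2 | x \in f] by rewrite inE fC Ef set21.
rewrite E !inE {1 2}Ef => /orP[]/eqP/set2_inj[] [e1 e2];
  try (by rewrite e2 eqxx in nxy).
  by rewrite connect_link_sym Ef e2.
by rewrite Ef e2.
Qed.

Lemma cycle_connect C u v : is_cycle C -> u \in C.1 -> v \in C.1 -> connect (link C.2) u v.
Proof.
move=> cC uC vC; case: (cycle_at cC uC) => a [s [b [_ E1 E2 _]]].
have: path (link C.2) u (a :: rcons (rcons s b) u) by rewrite path_link E2.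
have: v \in u :: a :: rcons (rcons s b) u.
  rewrite E1 in_set in vC; rewrite -!rcons_cons mem_rcons in_cons.
  by apply/orP; right; exact: vC.
by case/splitPl=> p1 p2 <-; rewrite cat_path => /andP[up _]; apply/connectP; exists p1.
Qed.

(** Two paths that part at [x] and meet again close a cycle: follow the first one up to its
    first vertex [z] on the second one, and come back along the second one.  Beyond [z] the
    second path has left this cycle for good. *)
Lemma fork_cycle x a b p q :
    trail [:: x, a & p] \subset edges G -> trail [:: x, b & q] \subset edges G ->
    uniq [:: x, a & p] -> uniq [:: x, b & q] -> last a p = last b q -> a != b ->
  exists C z, [/\ is_cycle C, [set x; a] \in C.2, [set x; b] \in C.2,
    {subset C.1 <= [:: x, a & p] ++ (b :: q)}
    & z \in C.1 :\ x /\ connect (link (edges G :\: C.2)) z (last b q)].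
Proof.
move=> xp xq Up Uq el nab.
have [p1 [z [p2 [Ep zq p1q]]]] : exists p1 z p2,
    [/\ a :: p = p1 ++ z :: p2, z \in b :: q & ~~ has (mem (b :: q)) p1].
  have: has (mem (b :: q)) (a :: p).
    by apply/hasP; exists (last a p); rewrite ?mem_last //= el mem_last.
  move: (a :: p) => r /split_find[z p1 p2 zq p1q].
  by exists p1, z, p2; rewrite cat_rcons.
have [q1 [q2 Eq]] : exists q1 q2, b :: q = q1 ++ z :: q2.
  by case/splitPr: zq => q1 q2; exists q1, q2.
have el2 : last b q = last z q2 by rewrite -[last b q]/(last x (b :: q)) Eq last_cat.
have hd1 : [set x; a] \in trail (x :: rcons p1 z).
  by case: p1 Ep {p1q} => [|? ?] [<- _]; rewrite /= trail_cons setU11.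
have hd2 : [set x; b] \in trail (x :: rcons q1 z).
  by case: q1 Eq => [|? ?] [<- _]; rewrite /= trail_cons setU11.
have sz : 0 < size p1 + size q1.
  case: p1 q1 Ep Eq {p1q hd1 hd2} => [|//] [|? ?] [e1 _] [e2 _]; last by rewrite addnS.
  by rewrite e1 e2 eqxx in nab.
rewrite Ep in xp Up *; rewrite Eq in xq Uq p1q *; rewrite el2 => {Ep Eq el el2 zq nab}.
pose c := x :: p1 ++ z :: rev q1.
have cE : trail (x :: rcons (p1 ++ z :: rev q1) x) =
    trail (x :: rcons p1 z) :|: trail (x :: rcons q1 z).
  rewrite -cats1 -catA cat_cons -cat_cons trail_cat -rcons_cons; congr (_ :|: _).
  by rewrite -[RHS]trail_rev rev_cons rev_rcons /= cats1.
have Uc : uniq c.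
  have /and3P[xq1 Uq1 zq1] : [&& x \notin q1, uniq q1 & z \notin q1].
    move: Uq; rewrite /= mem_cat cat_uniq /= !negb_or.
    by move=> /and3P[/andP[-> _] -> /and3P[/andP[-> _]]].
  move: Up; rewrite /c -!cat_cons !cat_uniq => /and3P[-> zp _] /=.
  rewrite mem_rev zq1 rev_uniq Uq1 !andbT negb_or; apply/andP; split.
    by apply: contra zp => zp; apply/hasP; exists z; rewrite ?mem_head.
  apply/hasPn=> v; rewrite mem_rev => vq1; rewrite inE negb_or.
  rewrite (memPn xq1) //=; apply: contra p1q => vp1; apply/hasP; exists v => //=.
  by rewrite mem_cat vq1.
pose C := cycle_subgraph c; exists C, z.
have Cv v : (v \in C.1) = [|| v == x, v \in p1, v == z | v \in q1].
  by rewrite !inE mem_cat inE mem_rev.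
have C2 : C.2 = trail (x :: rcons p1 z) :|: trail (x :: rcons q1 z) by rewrite -cE -cycle_edgesE.
split.
- apply/cycleP; exists c; split=> //.
    by rewrite /c /= size_cat /= size_rev; lia.
  rewrite /= path_adj cE subUset; apply/andP; split.
    by apply: subset_trans xp; rewrite -cat_cons trail_cat subsetUl.
  by apply: subset_trans xq; rewrite -cat_cons trail_cat subsetUl.
- by rewrite C2 inE hd1.
- by rewrite C2 inE hd2 orbT.
- move=> v; rewrite Cv mem_cat inE !mem_cat !inE.
  by case/or4P=> ->; rewrite ?orbT.
split.
  rewrite in_setD1 Cv eqxx !orbT andbT; apply: contraTneq Up => ->.
  by rewrite /= mem_cat mem_head orbT.
apply: trail_connect; apply/subsetP=> f fz; rewrite in_setD; apply/andP; split; last first.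
  by apply: (subsetP xq); rewrite -cat_cons trail_cat inE fz orbT.
apply/negP=> fC; have [v vf vq2] := trail_meets fz.
have: v \in C.1.
  rewrite Cv; move: fC; rewrite C2 => /setUP[]/trail_sub/(_ vf);
  by rewrite in_cons mem_rcons in_cons => /or3P[]->; rewrite ?orbT.
rewrite Cv; case/or4P=> [/eqP e|vp1|/eqP e|vq1].
- by move: Uq; rewrite -e /= mem_cat in_cons vq2 !orbT.
- by case/hasP: p1q; exists v => //=; rewrite mem_cat in_cons vq2 !orbT.
- by move: Uq; rewrite -e /= cat_uniq /= vq2 !andbF.
by move: Uq; rewrite /= cat_uniq => /and4P[_ _ /hasP[]]; exists v; rewrite // in_cons vq2 orbT.
Qed.

(** Two distinct paths between the same ends part somewhere, and so close a cycle, which has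
    nothing else in common with them: before parting and after meeting again, the paths avoid it. *)
Lemma diverge_cycle x p q : trail (x :: p) \subset edges G -> trail (x :: q) \subset edges G ->
    uniq (x :: p) -> uniq (x :: q) -> last x p = last x q -> p != q ->
  exists C w z, [/\ is_cycle C, w \in C.1, z \in C.1 :\ w,
    connect (link (edges G :\: C.2)) x w /\ connect (link (edges G :\: C.2)) z (last x q)
    & exists a b,
        [/\ a != b, [set w; a] \in C.2, [set w; a] \in trail (x :: p) :\: trail (x :: q),
            [set w; b] \in C.2 & [set w; b] \in trail (x :: q) :\: trail (x :: p)]].
Proof.
move=> xp xq Up Uq el npq.
have [s [a [b [p' [q' [Ep Eq nab]]]]]] : exists s a b p' q',
    [/\ p = s ++ a :: p', q = s ++ b :: q' & a != b].
  elim: p x q {xp xq} Up Uq el npq => [|a p IH] x [|b q] //= Up Uq el npq.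
  - by case/andP: Uq; rewrite el mem_last.
  - by case/andP: Up; rewrite -el mem_last.
  have [eab|nab] := eqVneq a b; last by exists [::], a, b, p, q.
  have [||||s [c [d [p' [q' [-> -> ncd]]]]]] := IH a q.
  - by case/andP: Up.
  - by rewrite eab; case/andP: Uq.
  - by rewrite el eab.
  - by apply: contraNneq npq => ->; rewrite eab.
  by rewrite eab; exists (b :: s), c, d, p', q'.
rewrite {}Ep {}Eq in xp xq Up Uq el *.
rewrite !last_cat /= in el *.
set w := last x s.
have Ew r : x :: s ++ r = belast x s ++ w :: r by rewrite -cat_cons lastI cat_rcons.
rewrite !Ew in xp xq Up Uq *.
have wp : trail [:: w, a & p'] \subset edges G.
  by apply: subset_trans xp; rewrite trail_cat subsetUr.
have wq : trail [:: w, b & q'] \subset edges G.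
  by apply: subset_trans xq; rewrite trail_cat subsetUr.
have Uwp : uniq [:: w, a & p'] by move: Up; rewrite cat_uniq => /and3P[].
have Uwq : uniq [:: w, b & q'] by move: Uq; rewrite cat_uniq => /and3P[].
have [C [z [cC aC bC C1 [zC zl]]]] := fork_cycle wp wq Uwp Uwq el nab.
have Cs v : v \in belast x s -> v \notin C.1.
  move=> vs; apply/negP=> /C1; rewrite mem_cat => /orP[vp|vq].
    by move: Up; rewrite cat_uniq => /and3P[_ /hasP[]]; exists v.
  by move: Uq; rewrite cat_uniq => /and3P[_ /hasP[]]; exists v; rewrite // in_cons vq orbT.
exists C, w, z; split=> //.
- by apply: (cycle_edge_ends cC aC); rewrite set21.
- split=> //; rewrite /w; apply: trail_connect; rewrite lastI -/w; apply/subsetP=> f fs.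
  rewrite in_setD; apply/andP; split; last first.
    by apply: (subsetP xp); rewrite trail_cat inE fs.
  have [v vf vs] := trail_meets_rcons fs.
  by apply: contra (Cs v vs) => fC; apply: (cycle_edge_ends cC fC).
have meets c r : [set w; c] \in trail (belast x s ++ [:: w, c & r]).
  by rewrite trail_cat trail_cons !inE eqxx orbT.
have misses c d r : uniq [:: w, c & r] -> c != d -> [set w; d] \in C.2 ->
    [set w; d] \notin trail (belast x s ++ [:: w, c & r]).
  move=> Uwc ncd dC; have wd := edge_neq (subsetP (cycle_edges_sub cC) _ dC).
  rewrite trail_cat trail_cons !in_setU in_set1 !negb_or; apply/and3P; split.
  - apply/negP=> /trail_sub/(_ (set22 _ _)); rewrite mem_rcons in_cons eq_sym (negPf wd) /=.
    by move=> /Cs; rewrite (cycle_edge_ends cC dC) ?set22.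
  - apply/eqP=> /set2_inj[] [e1 e2]; first by rewrite e2 eqxx in ncd.
    by rewrite e2 eqxx in wd.
  by apply/negP=> /trail_sub/(_ (set21 _ _)); case/andP: Uwc => /negP.
by exists a, b; split; rewrite // in_setD meets misses // eq_sym.
Qed.

End Cycles.

(** * Gates, and the number of paths between two vertices *)

Section Gates.
Variable G : sgraph.
Implicit Types (x y z u v w : G) (s p q : seq G) (P C D : subgraph G).
Implicit Types (f : {set G}) (F : {set {set G}}).

Definition away C : rel G := connect (link (edges G :\: C.2)).

(** When [C] is a cycle of a connected graph the search succeeds, see [gateP], so the default
    value is immaterial. *)
Definition gate C x : G := odflt x [pick u in C.1 | away C x u].

Definition separators x y : {set subgraph G} :=
  [set C in cycles G | gate C x != gate C y].

Hypothesis Gcactus : cactus G.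

Lemma cactus_connect x y : connect (link (edges G)) x y.
Proof.
case/andP: Gcactus => /andP[_ /forallP/(_ x)/forallP/(_ y)] + _.
by rewrite (eq_connect (@adjE G)).
Qed.

Lemma cycle_eq C D f : is_cycle C -> is_cycle D -> f \in C.2 -> f \in D.2 -> C = D.
Proof.
move=> cC cD fC fD; case/andP: Gcactus => _ /forall_inP/(_ f).
move=> /(_ (subsetP (cycle_edges_sub cC) _ fC))/card_le1_eqP; apply; by rewrite !inE ?cC ?cD.
Qed.

(** Two vertices of a cycle cannot be joined without using its edges: this path and an arc of
    the cycle would close a second cycle through an edge of the first. *)
Lemma away_inj C u v : is_cycle C -> u \in C.1 -> v \in C.1 -> away C u v -> u = v.
Proof.
move=> cC uC vC /connect_trail[p [up Up lp]].
have /subsetP CG := cycle_edges_sub cC.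
have upG : trail (u :: p) \subset edges G by apply: subset_trans up (subsetDl _ _).
have [q [uq Uq lq]] := connect_trail (cycle_connect cC uC vC).
have uqG : trail (u :: q) \subset edges G by apply: subset_trans uq (cycle_edges_sub cC).
apply/eqP; case: eqVneq => // nuv.
have npq : p != q.
  apply: contraNneq nuv => epq; rewrite -lp; case: p up {upG Up lp} epq => //= a p up epq.
  move: up uq; rewrite -epq trail_cons !subUset !sub1set in_setD => /andP[/andP[/negP nC _] _].
  by case/andP.
have el : last u p = last u q by rewrite lp lq.
have [D [w [_ [cD _ _ _ [a [b [_ aD /setDP[ap _] bD /setDP[bq _]]]]]]]] :=
  diverge_cycle upG uqG Up Uq el npq.
have eDC : D = C by apply: (cycle_eq cD cC bD); apply: (subsetP uq).
by have /setDP[_ /negP[]] := subsetP up _ ap; rewrite -eDC.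
Qed.

Lemma away_sym C x y : away C x y = away C y x.
Proof. exact: connect_link_sym. Qed.

Lemma away_trans C x y z : away C x y -> away C y z -> away C x z.
Proof. exact: connect_trans. Qed.

(** The vertices connected to [C] without its edges are closed under adjacency, because the
    ends of an edge of [C] are on [C]; so they are all the vertices. *)
Lemma gateP C x : is_cycle C -> gate C x \in C.1 /\ away C x (gate C x).
Proof.
move=> cC; rewrite /gate; case: pickP => [u /andP[]//|none].
have [u uC] := cycle_vertex cC.
pose R y := [exists v in C.1, away C y v].
suff cR y z : link (edges G) y z -> R y -> R z.
  have Ru : R u by apply/exists_inP; exists u => //; apply: connect0.
  have /connectP[p up ex] := cactus_connect u x.
  suff /exists_inP[v vC xv] : R x by move: (none v); rewrite /= vC xv.
  rewrite ex; elim: p u {uC ex} Ru up => //= v p IH u Ru /andP[uv vp].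
  by apply: IH vp; apply: cR Ru.
move=> yz /exists_inP[v vC yv]; apply/exists_inP.
have [yzC|yzC] := boolP ([set y; z] \in C.2).
  by exists z; [apply: (cycle_edge_ends cC yzC); rewrite set22|apply: connect0].
exists v => //; apply: away_trans yv; rewrite away_sym; apply: connect1.
by rewrite linkE in_setD yzC.
Qed.

Lemma gate_in C x : is_cycle C -> gate C x \in C.1.
Proof. by move=> /(gateP x)[]. Qed.

Lemma gate_away C x : is_cycle C -> away C x (gate C x).
Proof. by move=> /(gateP x)[]. Qed.

Lemma gate_eq C x u : is_cycle C -> u \in C.1 -> away C x u -> gate C x = u.
Proof.
move=> cC uC xu; apply: (away_inj cC) => //; first exact: gate_in.
by apply: away_trans xu; rewrite away_sym gate_away.
Qed.

Lemma gate_id C u : is_cycle C -> u \in C.1 -> gate C u = u.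
Proof. by move=> cC uC; apply: gate_eq => //; apply: connect0. Qed.

Lemma gate_away_eq C x y : is_cycle C -> away C x y -> gate C x = gate C y.
Proof.
move=> cC xy; apply: gate_eq => //; first exact: gate_in.
by apply: away_trans xy (gate_away _ _).
Qed.

(** Cutting at most one edge of each cycle does not disconnect the graph: a cut edge is bypassed
    by the rest of its cycle, which is not cut anywhere else. *)
Lemma connect_cut F x y :
    (forall f, f \in F -> exists2 C, is_cycle C /\ f \in C.2 & C.2 :&: F \subset [set f]) ->
  connect (link (edges G :\: F)) x y.
Proof.
move=> cutF; apply: connect_sub (cactus_connect x y) => {}x {}y xy.
have [xyF|xyF] := boolP ([set x; y] \in F); last by apply: connect1; rewrite linkE in_setD xyF.
have [C [cC xyC] /subsetP CF] := cutF _ xyF.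
apply: connect_sub (cycle_connect_avoid cC xyC (erefl _)) => a b /setD1P[nab abC].
apply: connect1; rewrite linkE in_setD (subsetP (cycle_edges_sub cC)) // andbT.
by apply: contra nab => abF; rewrite -in_set1 CF // inE abC.
Qed.

(** One of the two edges of [C] at [u], to serve as reference: a path leaving [u] around [C]
    either starts along it or does not. *)
Definition arm C u : {set G} := odflt set0 [pick f in [set f in C.2 | u \in f]].

Lemma armP C u : is_cycle C -> u \in C.1 -> arm C u \in [set f in C.2 | u \in f].
Proof.
move=> cC uC; rewrite /arm; case: pickP => // none.
by have := card_cycle_at cC uC; rewrite eq_card0.
Qed.

(** The gate changes only along an edge of [C], and behind [gate C x] the only such edges are
    the two at [gate C x]. *)
Lemma gate_stuck C x y : is_cycle C ->
    connect (link (edges G :\: [set f in C.2 | gate C x \in f])) x y -> gate C x = gate C y.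
Proof.
move=> cC /connectP[p + ->]; set g := gate C x; have: gate C x = g by [].
clearbody g; elim: p x => //= z p IH w gw /andP[wz zp].
move: wz; rewrite linkE in_setD inE negb_and => /andP[nC wz].
have wzC : [set w; z] \notin C.2.
  apply/negP=> wzC; have wC : w \in C.1 by apply: (cycle_edge_ends cC wzC); rewrite set21.
  by move: nC; rewrite wzC -gw gate_id // set21.
apply: IH zp; rewrite -gw; apply/esym/gate_away_eq => //; apply: connect1.
by rewrite linkE in_setD wzC.
Qed.

(** A path from [x] to [y] chooses, at each cycle separating [x] from [y], one of the two edges
    by which it leaves the gate of [x].  The choices are free: cut the edges not chosen, by
    [connect_cut] some path remains, and by [gate_stuck] it uses the chosen ones.  They determine
    the path: two distinct paths part at the gate of [x] on some cycle, one along each edge. *)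
Theorem card_paths_between x y : #|paths_between x y| = 2 ^ #|separators x y|.
Proof.
pose phi P := [set C in separators x y | arm C (gate C x) \in P.2].
have sepP C : C \in separators x y -> is_cycle C /\ gate C x != gate C y.
  by rewrite !inE => /andP[].
rewrite -card_powerset; have <- : phi @: paths_between x y = powerset (separators x y).
  apply/setP=> A; rewrite powersetE; apply/imsetP/idP => [[P _ ->]|/subsetP Asep].
    by apply/subsetP=> C; rewrite inE => /andP[].
  pose at_gate C := [set f in C.2 | gate C x \in f].
  (* The edge of [C] to be avoided by a path that starts along [arm] exactly at the cycles in
     [A]. *)
  pose cut C := if C \in A then at_gate C :\ arm C (gate C x) else [set arm C (gate C x)].
  have cut_sub C : C \in separators x y -> cut C \subset at_gate C.
    case/sepP=> cC _; rewrite /cut; case: ifP; rewrite ?subD1set // sub1set.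
    by rewrite armP ?gate_in.
  pose F := \bigcup_(C in separators x y) cut C.
  have [|p [xp Up lp]] := @connect_trail _ (edges G :\: F) x y.
    apply: connect_cut => f /bigcupP[C sC fC]; have [cC _] := sepP _ sC.
    have fC2 : f \in C.2 by have := subsetP (cut_sub _ sC) _ fC; rewrite inE => /andP[].
    exists C => //; apply/subsetP=> g /setIP[gC /bigcupP[D sD gD]].
    have [cD _] := sepP _ sD.
    have gD2 : g \in D.2 by have := subsetP (cut_sub _ sD) _ gD; rewrite inE => /andP[].
    have {}gD : g \in cut C by rewrite (cycle_eq cC cD gC gD2).
    have: #|cut C| <= 1.
      rewrite /cut; case: ifP => _; last by rewrite cards1.
      have : #|at_gate C| = 2 by apply: card_cycle_at; rewrite ?gate_in.
      by rewrite (cardsD1 (arm C (gate C x))) armP ?gate_in // add1n => -[->].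
    by rewrite inE => /card_le1_eqP H; apply/eqP/H.
  have xpG : trail (x :: p) \subset edges G by apply: subset_trans xp (subsetDl _ _).
  exists (path_subgraph (x :: p)); first by apply/paths_betweenP; exists p.
  apply/setP=> C; rewrite inE -/(trail _); apply/idP/andP => [CA|[sC armp]].
    split; first exact: Asep.
    have sC := Asep _ CA; have [cC /eqP ngC] := sepP _ sC.
    apply/negPn/negP=> narm; apply: ngC; apply: gate_stuck => //.
    rewrite -lp; apply: trail_connect; apply/subsetP=> f fp; rewrite in_setD.
    rewrite (subsetP xpG) // andbT; apply/negP=> fC.
    have := subsetP xp _ fp; rewrite in_setD => /andP[/negP[]].
    apply/bigcupP; exists C => //; rewrite /cut CA in_setD1 fC andbT.
    by apply: contraNneq narm => <-.
  apply/negPn/negP=> nCA; have := subsetP xp _ armp; rewrite in_setD => /andP[/negP[]].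
  by apply/bigcupP; exists C => //; rewrite /cut (negPf nCA) set11.
rewrite card_in_imset // => P Q.
move=> /paths_betweenP[p [xp Up lp ->]] /paths_betweenP[q [xq Uq lq ->]] Epq.
congr path_subgraph; congr (_ :: _); apply/eqP; move/eqP: Epq; apply: contraTT => npq.
have el : last x p = last x q by rewrite lp lq.
have [C [w [z [cC wC /setD1P[zw zC] [xw zy] [a [b [nab aC /setDP[ap aq] bC /setDP[bq bp]]]]]]]] :=
  diverge_cycle xp xq Up Uq el npq.
have gx : gate C x = w by apply: gate_eq.
have gy : gate C y = z by apply: gate_eq => //; rewrite away_sym -lq.
have sC : C \in separators x y by rewrite !inE cC gx gy eq_sym.
have armE : arm C w \in [set [set w; a]; [set w; b]].
  suff <- : [set f in C.2 | w \in f] = [set [set w; a]; [set w; b]] by apply: armP.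
  apply/esym/eqP; rewrite eqEcard card_cycle_at // subUset !sub1set !inE aC bC !eqxx /= cards2.
  by case: eqP => // /set2_inj[] [e1 e2]; move: nab; rewrite e2 ?e1 eqxx.
have phiE r : (C \in phi (path_subgraph (x :: r))) = (arm C w \in trail (x :: r)).
  by rewrite [LHS]in_set sC gx.
apply/eqP=> /setP/(_ C); rewrite !phiE.
by case/set2P: armE => ->; rewrite ?ap ?bq ?(negPf aq) ?(negPf bp).
Qed.

End Gates.

(** * Counting separated pairs *)

Section Counting.
Variable G : sgraph.
Implicit Types (x y z u v w : G) (s p q : seq G) (P C D : subgraph G).
Implicit Types (f : {set G}) (F : {set {set G}}) (e : G * G).
Hypothesis Gcactus : cactus G.

Lemma card_edges_at u : #|[set f in edges G | u \in f]| = deg u.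
Proof.
have -> : [set f in edges G | u \in f] = [set [set u; y] | y in [set y | adj u y]].
  apply/setP=> f; rewrite inE; apply/andP/imsetP => [[/imsetP[[a b]]]|[y + ->]].
    rewrite inE /= => ab -> /set2P[]->; first by exists b; rewrite ?inE.
    by exists a; rewrite ?inE ?[adj b a]adj_sym // setUC.
  by rewrite inE set21 adjE.
by apply: card_imset => y z /set2_inj[[]|[e1 e2]] //; rewrite e2.
Qed.

Lemma cycle_edges_at C u : is_cycle C -> u \in C.1 -> deg u <= 2 ->
  [set f in C.2 | u \in f] = [set f in edges G | u \in f].
Proof.
move=> cC uC du; apply/eqP; rewrite eqEcard card_cycle_at // card_edges_at du andbT.
apply/subsetP=> f; rewrite !in_set => /andP[fC ->]; rewrite andbT.
exact: (subsetP (cycle_edges_sub cC)).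
Qed.

(** A third edge at [u] is not an edge of [C], and its other end is behind [u]. *)
Lemma behind_gate C u : is_cycle C -> u \in C.1 -> 2 < deg u ->
  exists2 z, z \notin C.1 & gate C z = u.
Proof.
move=> cC uC du; have [f fu fC] : exists2 f, f \in [set f in edges G | u \in f] & f \notin C.2.
  apply/exists_inP; apply: contraLR du => /exists_inPn nf.
  rewrite -leqNgt -card_edges_at -(card_cycle_at cC uC); apply: subset_leq_card.
  apply/subsetP=> f fu; rewrite inE; move: (nf f fu); rewrite negbK => ->.
  by move: fu; rewrite in_set => /andP[].
move: fu; rewrite in_set => /andP[fG uf].
have [z Ef] : exists z, f = [set z; u].
  case/imsetP: fG uf => -[a b] _ /= -> /set2P[]->; last by exists a.
  by exists b; rewrite setUC.
have gz : gate C z = u.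
  by apply: gate_eq => //; apply: connect1; rewrite linkE in_setD -Ef fC.
exists z => //; apply/negP=> zC; move: gz; rewrite gate_id // => ezu.
by have := edge_uniq fG Ef; rewrite ezu eqxx.
Qed.

(** Conversely, if [C] takes all edges at a vertex, then nothing is behind this vertex. *)
Lemma gate_deg2 C z : is_cycle C -> deg (gate C z) <= 2 -> gate C z = z.
Proof.
move=> cC dz; have gC := gate_in Gcactus z cC.
have := gate_away Gcactus z cC; rewrite away_sym => /connectP[[|a p] //= /andP[ga _] _].
move: ga; rewrite linkE in_setD => /andP[gaC gaG]; apply: contraNeq gaC => _.
have : [set gate C z; a] \in [set f in edges G | gate C z \in f] by rewrite in_set gaG set21.
by rewrite -(cycle_edges_at cC) // in_set => /andP[].
Qed.

(** Two cycles through a vertex of degree 2 share its edges. *)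
Lemma tip_cycle_eq C D u : is_cycle C -> is_cycle D -> u \in C.1 -> u \in D.1 -> deg u <= 2 ->
  C = D.
Proof.
move=> cC cD uC uD du; have := armP cC uC; rewrite cycle_edges_at // => armE.
have := armE; rewrite -(cycle_edges_at cC) // in_set => /andP[aC _].
move: armE; rewrite -(cycle_edges_at cD) // in_set => /andP[aD _].
exact: (cycle_eq Gcactus cC cD aC aD).
Qed.

(** Distinct cycles share no edge, so each lies behind a single vertex of the other. *)
Lemma gate_cycle C D u v : is_cycle C -> is_cycle D -> C != D -> u \in C.1 -> v \in C.1 ->
  gate D u = gate D v.
Proof.
move=> cC cD nCD uC vC; apply: gate_away_eq => //.
rewrite /away; apply: connect_sub (cycle_connect cC uC vC) => a b ab; apply: connect1.
rewrite linkE in_setD (subsetP (cycle_edges_sub cC)) // andbT.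
by apply: contra nCD => abD; apply/eqP/(cycle_eq Gcactus cC cD ab abD).
Qed.

Definition tips C : {set G} := [set x in C.1 | deg x <= 2].

(** Of the two distinct gates, one is not the attachment of the end-triangle, so it has degree 2
    and only itself behind it. *)
Lemma separated_tip C x y : end_triangle C -> gate C x != gate C y ->
  (x \in tips C) || (y \in tips C).
Proof.
case/andP=> /andP[cC /card_le1_eqP few] _; apply: contraR; rewrite negb_or => /andP[nx ny].
have big z : z \notin tips C -> gate C z \in [set x in C.1 | 2 < deg x].
  move=> nz; rewrite in_set gate_in //= ltnNge; apply: contra nz => dz.
  by rewrite in_set -(gate_deg2 cC dz) gate_in.
by apply/eqP/few; apply: big.
Qed.

Definition separated_pairs C D : nat :=
  \sum_(e : G * G) (gate C e.1 != gate C e.2) * (gate D e.1 != gate D e.2).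

Lemma separated_pairsxx C :
  separated_pairs C C = \sum_x \sum_y (gate C x != gate C y : nat).
Proof. by rewrite pair_big /=; apply: eq_bigr => e _; rewrite mulnb andbb. Qed.

(** Each vertex is separated from all vertices of [C] but its own gate, which counts the pairs
    with a member on [C]: there are [(g - 1) * (2 * n - g)] of them for [g] the length of [C], and
    this is least for [g = 3].  A pair outside [C] is separated only if two vertices of [C] have
    something behind them, that is, a degree above 2. *)
Lemma leqif_separated_pairsxx C : is_cycle C ->
  4 * #|G| <= separated_pairs C C + 6 ?= iff end_triangle C.
Proof.
move=> cC; set g := #|C.1|; set n := #|G|.
(* How many vertices of [C] are separated from [y]. *)
have row y : \sum_(x in C.1) (gate C x != gate C y : nat) = g.-1.
  rewrite (bigD1 (gate C y)) ?gate_in //= gate_id ?gate_in // eqxx add0n.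
  rewrite (eq_bigr (fun=> 1)) => [|x /andP[xC ng]]; last by rewrite gate_id // ng.
  rewrite sum1_card /g [in RHS](cardD1 (gate C y)) gate_in //=.
  by apply: eq_card => x; rewrite !inE andbC.
pose rest := \sum_(x | x \notin C.1) \sum_(y | y \notin C.1) (gate C x != gate C y : nat).
have E : separated_pairs C C = n * g.-1 + ((n - g) * g.-1 + rest).
  rewrite separated_pairsxx (bigID (mem C.1)) /=; congr (_ + _).
    rewrite exchange_big /=; under eq_bigr do rewrite row.
    by rewrite sum_nat_const.
  under eq_bigr do rewrite (bigID (mem C.1)) /=.
  rewrite big_split /=; congr (_ + _).
  under eq_bigr => x _.
    under eq_bigr do rewrite eq_sym.
    rewrite row; over.
  rewrite sum_nat_const; congr (_ * _); rewrite /n /g -(cardC (mem C.1)) addKn.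
  by apply: eq_card => x; rewrite !inE.
have g3 : 2 < g := cycle_gt2 cC.
have gn : g <= n := max_card _.
have [|nend] := boolP (end_triangle C).
  move=> eC; have [/andP[_ few] /eqP c3] := andP eC.
  have eg : g = 3 by rewrite /g -card_cycle.
  suff r0 : rest = 0 by rewrite /leqif E r0 eg; split; lia.
  apply: big1 => x xC; apply: big1 => y yC; case: eqVneq => // ng.
  by case/orP: (separated_tip eC ng); rewrite in_set => /andP[vC _]; rewrite vC in xC yC.
suff: 4 * n < separated_pairs C C + 6 by rewrite /leqif => lt; split; [exact: ltnW|rewrite ltn_eqF].
have [g4|] := ltnP 3 g.
  by rewrite E; case: g g3 gn g4 {row E} => // m _ gn g4; have := subnKC gn; nia.
move=> g3'; have {g3'} eg : g = 3 by lia.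
suff r1 : 0 < rest by rewrite E eg; lia.
have : 1 < #|[set x in C.1 | 2 < deg x]|.
  rewrite ltnNge; apply: contra nend => few.
  by rewrite /end_triangle /end_cycle cC few card_cycle // -/g eg.
case/card_gt1P=> u [v [+ + nuv]]; rewrite !in_set => /andP[uC du] /andP[vC dv].
have [x xC gx] := behind_gate cC uC du; have [y yC gy] := behind_gate cC vC dv.
by rewrite /rest (bigD1 x) //= (bigD1 y) //= gx gy nuv.
Qed.

(** The vertex [u] of [C] towards [D], and the vertex [v] of [D] towards [C]; both may be the
    same vertex of [G]. *)
Lemma cycle_ports C D : is_cycle C -> is_cycle D -> C != D ->
  exists u v, [/\ u \in C.1, v \in D.1, {in D.1, forall x, gate C x = u}
    & {in C.1, forall x, gate D x = v}].
Proof.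
move=> cC cD nCD.
have [a aC] := cycle_vertex cC; have [b bD] := cycle_vertex cD.
exists (gate C b), (gate D a); split; rewrite ?gate_in // => x xX.
  by apply: (gate_cycle cD); rewrite // eq_sym.
exact: gate_cycle nCD xX aC.
Qed.

Lemma separated_pairsE C D : separated_pairs C D =
  #|[set e | (gate C e.1 != gate C e.2) && (gate D e.1 != gate D e.2)]|.
Proof.
rewrite -sum1_card big_mkcond /=; apply: eq_bigr => e _; rewrite in_set mulnb.
by case: ifP.
Qed.

(** The pairs made of a vertex of [C] other than [u] and a vertex of [D] other than [v], in either
    order: both cycles separate them, and no other pairs if [C] and [D] are end-triangles. *)
Lemma card_corners C D u v : is_cycle C -> is_cycle D ->
    u \in C.1 -> v \in D.1 -> {in D.1, forall x, gate C x = u} ->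
    {in C.1, forall x, gate D x = v} ->
  let A := setX (C.1 :\ u) (D.1 :\ v) in let B := setX (D.1 :\ v) (C.1 :\ u) in
  #|A :|: B| = 2 * (#|C.1|.-1 * #|D.1|.-1).
Proof.
move=> cC cD uC vD gC gD /=; rewrite cardsU.
have -> : setX (C.1 :\ u) (D.1 :\ v) :&: setX (D.1 :\ v) (C.1 :\ u) = set0.
  apply/setP=> -[x y]; rewrite !inE /=; apply/negP.
  move=> /andP[/andP[/andP[xu xC] _] /andP[/andP[_ xD] _]].
  by case/eqP: xu; rewrite -(gC x xD) gate_id.
have c1 : #|C.1 :\ u| = #|C.1|.-1 by rewrite (cardsD1 u C.1) uC.
have d1 : #|D.1 :\ v| = #|D.1|.-1 by rewrite (cardsD1 v D.1) vD.
by rewrite cards0 subn0 !cardsX c1 d1 mul2n -addnn [X in _ + X]mulnC.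
Qed.

Lemma separated_pairs_ge8 C D : is_cycle C -> is_cycle D -> C != D -> 8 <= separated_pairs C D.
Proof.
move=> cC cD nCD; have [u [v [uC vD gC gD]]] := cycle_ports cC cD nCD.
have /= := card_corners cC cD uC vD gC gD; set S := _ :|: _ => cS.
have := cycle_gt2 cC; have := cycle_gt2 cD; move: #|C.1| #|D.1| cS => c d cS d3 c3.
apply: (@leq_trans #|S|); first by rewrite cS; nia.
rewrite separated_pairsE; apply: subset_leq_card; apply/subsetP=> -[x y].
rewrite !inE /= => /orP[/andP[/andP[xu xC] /andP[yv yD]]|/andP[/andP[xv xD] /andP[yu yC]]].
  by rewrite (gate_id _ cC xC) // (gC y) // (gD x) // (gate_id _ cD yD) // xu eq_sym yv.
by rewrite (gate_id _ cC yC) // (gC x) // (gD y) // (gate_id _ cD xD) // xv eq_sym yu.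
Qed.

(** The vertex towards [D] has vertices of [D] behind it, so its degree exceeds 2. *)
Lemma tips_sub C D u : is_cycle C -> is_cycle D -> u \in C.1 -> {in D.1, forall x, gate C x = u} ->
  tips C \subset C.1 :\ u.
Proof.
move=> cC cD uC gC; apply/subsetP=> x; rewrite !inE => /andP[xC dx]; rewrite xC andbT.
apply/eqP=> exu; have /card_gt0P[y] : 0 < #|D.1 :\ u|.
  by have := cardsD1 u D.1; have := cycle_gt2 cD; lia.
rewrite !inE => /andP[yu yD]; case/eqP: yu; rewrite -[RHS](gC y yD).
by apply/esym/gate_deg2 => //; rewrite gC // -exu.
Qed.

Lemma separated_pairs_end C D :
  end_triangle C -> end_triangle D -> C != D -> separated_pairs C D = 8.
Proof.
move=> eC eD nCD; have [/andP[cC _] /eqP c3] := andP eC; have [/andP[cD _] /eqP d3] := andP eD.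
apply/eqP; rewrite eqn_leq separated_pairs_ge8 // andbT.
have [u [v [uC vD gC gD]]] := cycle_ports cC cD nCD.
have /= := card_corners cC cD uC vD gC gD; set S := _ :|: _.
rewrite -!card_cycle // c3 d3 -[2 * _]/8 => <-.
rewrite separated_pairsE; apply: subset_leq_card; apply/subsetP=> -[x y]; rewrite !inE /=.
move=> /andP[/(separated_tip eC) sC /(separated_tip eD) sD].
have tC := subsetP (tips_sub cC cD uC gC); have tD := subsetP (tips_sub cD cC vD gD).
have no z : z \in tips C -> z \in tips D -> False.
  rewrite !in_set => /andP[zC dz] /andP[zD _]; case/eqP: nCD.
  exact: (tip_cycle_eq cC cD zC zD dz).
have := tC x; have := tC y; have := tD x; have := tD y; rewrite !in_setD1.
case/orP: sC => hC; case/orP: sD => hD; rewrite hC hD;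
  try (by case: (no _ hC hD)).
  by move=> -> // _ _ -> //.
by move=> _ -> // -> // _; rewrite orbT.
Qed.

(** A separating end-triangle has [x] or [y] as a tip, and a vertex is a tip of at most one. *)
Lemma separators_end x y : {in cycles G, forall C, end_triangle C} -> #|separators x y| <= 2.
Proof.
move=> allE; pose T z := [set C in cycles G | z \in tips C].
have T1 z : #|T z| <= 1.
  apply/card_le1_eqP => C D; rewrite !in_set => /andP[cC /andP[zC dz]] /andP[cD /andP[zD _]].
  exact: (tip_cycle_eq cD cC zD zC dz).
apply: leq_trans (leq_add (T1 x) (T1 y)); apply: leq_trans (leq_card_setU _ _).
apply: subset_leq_card; apply/subsetP=> C; rewrite in_set => /andP[cC sC].
rewrite in_setU [C \in T x]in_set [C \in T y]in_set cC /=.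
exact: separated_tip (allE C cC) sC.
Qed.

Lemma leqif_exp2 c : 2 + c + c ^ 2 <= 2 * 2 ^ c ?= iff (c <= 2).
Proof.
suff H m : 2 + m.+3 + m.+3 ^ 2 < 2 * 2 ^ m.+3.
  case: c => [|[|[|m]]]; try by split.
  by split; [exact: ltnW|rewrite ltn_eqF].
by elim: m => [//|m IH]; rewrite (expnS 2 m.+3); move: IH; lia.
Qed.

(** Double counting: [c] is a sum over the cycles, and [c ^ 2] a sum over the pairs of cycles, of
    which the diagonal is again the sum [c]. *)
Lemma sum_separators :
  \sum_(e : G * G) (2 + #|separators e.1 e.2| + #|separators e.1 e.2| ^ 2) =
  2 * #|G| ^ 2 + 2 * (\sum_(C in cycles G) separated_pairs C C)
    + \sum_(C in cycles G) \sum_(D in cycles G | D != C) separated_pairs C D.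
Proof.
pose b C e : nat := gate C e.1 != gate C e.2.
have sE e : #|separators e.1 e.2| = \sum_(C in cycles G) b C e.
  rewrite -sum1_card big_mkcond [RHS]big_mkcond; apply: eq_bigr => C _.
  by rewrite !in_set; case: ifP => /=; case: ifP; rewrite /b; case: eqP.
rewrite !big_split /= sum_nat_const card_prod mulnn [_ * 2]mulnC.
have -> : \sum_(e : G * G) #|separators e.1 e.2| = \sum_(C in cycles G) separated_pairs C C.
  rewrite (eq_bigr _ (fun e _ => sE e)) exchange_big; apply: eq_bigr => C _.
  by apply: eq_bigr => e _; rewrite mulnb andbb.
have -> : \sum_(e : G * G) #|separators e.1 e.2| ^ 2 =
    \sum_(C in cycles G) \sum_(D in cycles G) separated_pairs C D.
  have sE2 e : #|separators e.1 e.2| ^ 2 =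
      \sum_(C in cycles G) \sum_(D in cycles G) b C e * b D e.
    by rewrite sE -mulnn big_distrlr.
  rewrite (eq_bigr _ (fun e _ => sE2 e)) exchange_big; apply: eq_bigr => C _.
  by rewrite exchange_big.
have -> : \sum_(C in cycles G) \sum_(D in cycles G) separated_pairs C D =
    \sum_(C in cycles G) separated_pairs C C +
    \sum_(C in cycles G) \sum_(D in cycles G | D != C) separated_pairs C D.
  by rewrite -big_split /=; apply: eq_bigr => C cC; rewrite (bigD1 C).
by rewrite [2 * (\sum_(C in _) _)]mul2n -addnn !addnA.
Qed.

(** The three estimates, for single cycles, for pairs of cycles and for [2 ^ c], are equalities
    when all cycles are end-triangles, and the first one is strict otherwise. *)
Theorem leqif_pn :
  (#|G| + 2 * #|cycles G|) ^ 2 + #|G| <= 2 * pn G + 10 * #|cycles G|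
    ?= iff [forall C in cycles G, end_triangle C].
Proof.
set n := #|G|; set k := #|cycles G|.
pose W := \sum_(e : G * G) (2 + #|separators e.1 e.2| + #|separators e.1 e.2| ^ 2).
pose X := \sum_(C in cycles G) separated_pairs C C.
pose Y := \sum_(C in cycles G) \sum_(D in cycles G | D != C) separated_pairs C D.
have EW : W = 2 * n ^ 2 + 2 * X + Y := sum_separators.
have pnE : 2 * (2 * pn G) = 2 * n + \sum_(e : G * G) 2 * 2 ^ #|separators e.1 e.2|.
  rewrite pn_paths_between pair_big mulnDr big_distrr /=; congr (_ + _).
  by apply: eq_bigr => e _; rewrite card_paths_between.
set S := \sum_(e : G * G) 2 * _ in pnE.
have SW : W <= S ?= iff [forall e : G * G, #|separators e.1 e.2| <= 2].
  by apply: leqif_sum => e _; apply: leqif_exp2.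
have XW : 4 * n * k <= X + 6 * k ?= iff [forall C in cycles G, end_triangle C].
  have -> : X + 6 * k = \sum_(C in cycles G) (separated_pairs C C + 6).
    by rewrite big_split /= sum_nat_const mulnC.
  rewrite mulnC -sum_nat_const; apply: leqif_sum => C; rewrite in_set => cC.
  exact: leqif_separated_pairsxx.
have kE C : C \in cycles G -> #|[pred D in cycles G | D != C]| = k.-1.
  move=> cC; rewrite /k (cardD1 C) cC /=; apply: eq_card => D; rewrite !inE.
  by rewrite andbC.
have EY : k * (k.-1 * 8) = \sum_(C in cycles G) \sum_(D in cycles G | D != C) 8.
  rewrite -sum_nat_const; apply: eq_bigr => C cC; rewrite -(kE C cC) -sum_nat_const.
  by apply: eq_bigl => D; rewrite !inE.
have YW : k * (k.-1 * 8) <= Y.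
  rewrite EY; apply: leq_sum => C cC; apply: leq_sum => D /andP[cD nDC].
  by rewrite !in_set in cC cD; rewrite separated_pairs_ge8 // eq_sym.
have kk : k * (k.-1 * 8) + 8 * k = 8 * k ^ 2 by case: (k) => // m; rewrite -pred_Sn; lia.
have [leX eqX] := XW; have [leS eqS] := SW.
have [/forall_inP allE|nall] := boolP [forall C in cycles G, end_triangle C].
  have EYe : k * (k.-1 * 8) = Y.
    rewrite EY; apply: eq_bigr => C cC; apply: eq_bigr => D /andP[cD nDC].
    by rewrite separated_pairs_end ?allE // eq_sym.
  have ES : W = S.
    by apply/eqP; rewrite eqS; apply/forallP=> e; apply: separators_end.
  have EX : 4 * n * k = X + 6 * k by apply/eqP; rewrite eqX; apply/forall_inP.
  have E : (n + 2 * k) ^ 2 + n = 2 * pn G + 10 * k by nia.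
  by split; rewrite ?E ?eqxx.
have ltX : 4 * n * k < X + 6 * k by rewrite ltn_neqAle leX eqX nall.
have lt : (n + 2 * k) ^ 2 + n < 2 * pn G + 10 * k by nia.
by split; [exact: ltnW|rewrite ltn_eqF].
Qed.

(** If the gate of [x] on [D] is not the vertex towards [C], then [x] reaches [D] without meeting
    [C], so that it is seen from [C] in the direction of [D]. *)
Lemma gate_or C D x u v : is_cycle C -> is_cycle D -> 
    {in D.1, forall x, gate C x = u} -> {in C.1, forall x, gate D x = v} ->
  gate C x = u \/ gate D x = v.
Proof.
move=> cC cD gC gD; have [->|nx] := eqVneq (gate D x) v; first by right.
left; rewrite -(gC (gate D x)) ?gate_in //; apply: gate_away_eq => //.
have /connectP[p xp ->] := gate_away Gcactus x cD.
elim: p x nx xp => [|z p IH] x nx /=; first by move=> _; apply: connect0.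
move=> /andP[xz zp]; have gxz : gate D x = gate D z by apply: gate_away_eq (connect1 _).
apply: away_trans (IH z _ zp); last by rewrite -gxz.
apply: connect1; move: xz; rewrite !linkE !in_setD => /andP[_ ->]; rewrite andbT.
by apply: contra nx => xzC; rewrite gD // (cycle_edge_ends cC xzC) ?set21.
Qed.

(** Remove from each cycle its gate towards a fixed vertex [x0].  What remains has at least two
    vertices, does not contain [x0], and is disjoint from what remains of the other cycles: on a
    common vertex of two cycles, [gate_or] would place the gate of [x0] on one of them. *)
Lemma cactus_size : 2 * #|cycles G| < #|G|.
Proof.
have /andP[/andP[/card_gt0P[x0 _] _] _] := Gcactus.
pose T C := C.1 :\ gate C x0.
have TC C : C \in cycles G -> 2 <= #|T C|.
  rewrite in_set => cC; have := cycle_gt2 cC.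
  by rewrite (cardsD1 (gate C x0)) gate_in.
apply: (@leq_ltn_trans (\sum_(C in cycles G) #|T C|)).
  by rewrite mulnC -sum_nat_const; apply: leq_sum.
rewrite (cardD1 x0) inE add1n ltnS.
have -> : \sum_(C in cycles G) #|T C| = \sum_x #|[set C in cycles G | x \in T C]|.
  under eq_bigr do rewrite -sum1_card.
  rewrite (exchange_big_dep xpredT) //=; apply: eq_bigr => x _.
  by rewrite -sum1_card; apply: eq_bigl => C; rewrite in_set.
rewrite (bigD1 x0) //= [X in X + _](_ : _ = 0) ?add0n; last first.
  apply/eqP; rewrite cards_eq0; apply/eqP/setP=> C; rewrite !inE; apply/negP.
  by case/andP=> cC /andP[/eqP + x0C]; rewrite gate_id.
have <- : \sum_(x | x != x0) 1 = #|[predD1 G & x0]|.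
  by rewrite sum1_card; apply: eq_card => x; rewrite !inE andbT.
apply: leq_sum => v _; apply/card_le1_eqP => D C; rewrite !inE.
move=> /andP[cD /andP[vD vDD]] /andP[cC /andP[vC vCC]]; apply/eqP.
apply: contraT => nCD; have [u [w [_ _ gC gD]]] := cycle_ports cC cD nCD.
have eu : u = v by rewrite -(gC v) // gate_id.
have ew : w = v by rewrite -(gD v) // gate_id.
by case: (gate_or x0 cC cD gC gD) => e; [case/eqP: vC|case/eqP: vD]; rewrite e.
Qed.

End Counting.

(** * A cactus all of whose cycles are end-triangles *)

Section Windmill.
Variables k m : nat.

(** The hub is [None]; the two tips of blade [i] are [Some (inl (i, true))] and
    [Some (inl (i, false))]; the [m] vertices [Some (inr j)] are leaves. *)
Definition windmill_vertex : finType := option ('I_k * bool + 'I_m).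

Definition windmill_adj : rel windmill_vertex := fun x y =>
  match x, y with
  | None, Some _ | Some _, None => true
  | Some (inl v), Some (inl w) => (v.1 == w.1) && (v.2 != w.2)
  | _, _ => false
  end.

Lemma windmill_sym : symmetric windmill_adj.
Proof.
by move=> [[v|i]|] [[w|j]|] //=; rewrite eq_sym [v.2 == _]eq_sym.
Qed.

Lemma windmill_irrefl : irreflexive windmill_adj.
Proof. by move=> [[v|i]|] //=; rewrite !eqxx. Qed.

Definition windmill : sgraph := SGraph windmill_sym windmill_irrefl.

Definition hub : windmill := None.
Definition blade (i : 'I_k) (b : bool) : windmill := Some (inl (i, b)).

Definition triangle i : subgraph windmill :=
  cycle_subgraph [:: hub; blade i true; blade i false].

Lemma adj_hub (x : windmill) : x != hub -> adj hub x.
Proof. by case: x. Qed.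

Lemma adj_blade (x y : windmill) : x != hub -> y != hub -> adj x y ->
  exists i b, x = blade i b /\ y = blade i (~~ b).
Proof.
move=> xh yh; move: x y xh yh => [[[i b]|?]|] // [[[j c]|?]|] // _ _.
rewrite -[adj _ _]/((i == j) && (b != c)) => /andP[/eqP-> bc].
exists j, b; split=> //; suff -> : c = ~~ b by [].
by case: (b) (c) bc => [] [].
Qed.

Lemma deg_rim (x : windmill) : x != hub -> deg x <= 2.
Proof.
move=> xh.
pose mate (v : windmill) : windmill := if v is Some (inl (i, b)) then blade i (~~ b) else hub.
apply: (@leq_trans #|[set hub; mate x]|); last by rewrite cards2; case: (_ != _).
apply: subset_leq_card; apply/subsetP=> y; rewrite !inE.
have [//|yh] := eqVneq y hub; rewrite /= => /(adj_blade xh yh)[i [b [-> ->]]].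
by rewrite /= eqxx.
Qed.

Lemma triangle_uniq i : uniq [:: hub; blade i true; blade i false].
Proof. by rewrite /= !inE /= andbT; apply/eqP=> -[]. Qed.

Lemma triangle_cycle i : is_cycle (triangle i).
Proof.
apply/cycleP; exists [:: hub; blade i true; blade i false].
by split; rewrite ?triangle_uniq //= eqxx.
Qed.

Lemma triangle_mem i (x : windmill) : x != hub -> x \in (triangle i).1 ->
  exists b, x = blade i b.
Proof.
move=> xh; rewrite !inE (negPf xh) /= => /orP[]/eqP->; first by exists true.
by exists false.
Qed.

Lemma triangle_edge_inj i j f : f \in (triangle i).2 -> f \in (triangle j).2 -> i = j.
Proof.
move=> fi fj; have fG := subsetP (cycle_edges_sub (triangle_cycle i)) f fi.
have [x xh xf] : exists2 x, x != hub & x \in f.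
  have /card_gt1P[x [y [xf yf xy]]] : 1 < #|f| by rewrite (card_edge fG).
  by case: (eqVneq x hub) => [ex|]; [exists y; rewrite // -ex eq_sym|exists x].
have [b eb] := triangle_mem xh (cycle_edge_ends (triangle_cycle i) fi xf).
have [c ec] := triangle_mem xh (cycle_edge_ends (triangle_cycle j) fj xf).
by move: ec; rewrite eb => -[].
Qed.

Lemma triangle_inj : injective triangle.
Proof.
move=> i j eij.
have [f fi] := cycle_edge (triangle_cycle i).
by apply: (triangle_edge_inj fi); rewrite -eij.
Qed.

(** A rim vertex has at most one neighbour besides the hub: so every cycle goes through the hub,
    and can only leave it for the two tips of a blade. *)
Lemma windmill_cycle C : is_cycle C -> exists i, C = triangle i.
Proof.
move=> cC; have hC : hub \in C.1.
  have [u uC] := cycle_vertex cC.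
  have [<-//|uh] := eqVneq u hub.
  have [a [b [nab E _ _]]] := cycle_local cC uC.
  have inC v : v \in [:: a; b] -> v \in C.1 /\ adj u v.
    rewrite !inE => vab; have : [set u; v] \in [set f in C.2 | u \in f].
      by rewrite E !inE; case/orP: vab => /eqP->; rewrite eqxx ?orbT.
    rewrite in_set => /andP[uv _]; split; first by rewrite (cycle_edge_ends cC uv) ?set22.
    by rewrite adjE linkE (subsetP (cycle_edges_sub cC)).
  have [aC ua] := inC a (mem_head _ _); have [|bC ub] := inC b; first by rewrite !inE eqxx orbT.
  have [<-//|ah] := eqVneq a hub; have [<-//|bh] := eqVneq b hub.
  have [i [c [eu ea]]] := adj_blade uh ah ua; have [j [d [eu' eb]]] := adj_blade uh bh ub.
  by case/eqP: nab; rewrite ea eb; move: eu'; rewrite eu => -[-> ->].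
case: (cycle_at cC hC) => a [s [b [U E1 E2 CG]]].
have: path (@adj windmill) a (rcons (rcons s b) hub).
  by move: CG; rewrite E2 -path_adj => /andP[].
move: U E1 E2; case: (rcons s b) (size_rcons s b) => // c r _ U E1 E2.
have /and4P[ah ch rh _] : [&& a != hub, c != hub, hub \notin r & uniq [:: a, c & r]].
  by move: U; rewrite cons_uniq !in_cons !negb_or ![hub == _]eq_sym -!andbA.
case: r U E1 E2 rh => [|d r] U E1 E2 rh /= /andP[ac ap]; last first.
  have dh : d != hub by move: rh; rewrite in_cons negb_or eq_sym => /andP[].
  have [i [t [ea ec]]] := adj_blade ah ch ac.
  case/andP: ap => /(adj_blade ch dh)[i' [t' [ec' ed]]] _.
  move: U; rewrite ea ed; move: ec'; rewrite ec => -[-> <-].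
  by rewrite negbK /= !inE eqxx !orbT andbF.
have [i [t [ea ec]]] := adj_blade ah ch ac.
exists i; rewrite [C]surjective_pairing [triangle i]surjective_pairing; congr (_, _).
  by rewrite E1 ea ec; apply/setP=> x; rewrite !inE; 
  case: t {ea ec}; first exact: erefl; congr (_ || _); exact: orbC.
rewrite E2 ea ec (cycle_edgesE (triangle_uniq i)).
case: t {ea ec}; [exact: erefl|exact: (trail_rev [:: hub; blade i true; blade i false; hub])].
Qed.

Lemma windmill_cycles : cycles windmill = [set triangle i | i : 'I_k].
Proof.
apply/setP=> C; rewrite in_set; apply/idP/imsetP => [/windmill_cycle[i ->]|[i _ ->]].
  by exists i.
exact: triangle_cycle.
Qed.

Lemma windmill_end C : C \in cycles windmill -> end_triangle C.
Proof.
rewrite windmill_cycles => /imsetP[i _ ->]; have cT := triangle_cycle i.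
have c3 : #|(triangle i).1| = 3 by rewrite cardsE (card_uniqP (triangle_uniq i)).
rewrite /end_triangle /end_cycle cT card_cycle // c3 andbT.
apply: (@leq_trans #|[set hub]|); last by rewrite cards1.
apply: subset_leq_card; apply/subsetP=> x.
rewrite in_set in_set1 => /andP[_]; apply: contraLR => xh; rewrite -leqNgt; exact: deg_rim.
Qed.

Lemma windmill_cactus : cactus_class windmill (2 * k + m).+1 k.
Proof.
apply/and3P; split.
- rewrite /cactus /connected; apply/andP; split; last first.
    apply/forall_inP=> f _; apply/card_le1_eqP => C D.
    rewrite !in_set => /andP[/windmill_cycle[i ->] fi] /andP[/windmill_cycle[j ->] fj].
    by rewrite (triangle_edge_inj fi fj).
  apply/andP; split; first by apply/card_gt0P; exists hub.
  have hubx x : connect (@adj windmill) hub x.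
    by have [->|/adj_hub/connect1] := eqVneq x hub; first exact: connect0.
  apply/forallP=> x; apply/forallP=> y; apply: connect_trans (hubx y).
  by rewrite (sym_connect_sym windmill_sym).
- by rewrite card_option card_sum card_prod card_bool !card_ord mulnC.
by rewrite windmill_cycles (card_imset _ triangle_inj) cardT size_enum_ord.
Qed.

End Windmill.

(** * Minimality *)

Theorem theorem14 (n k : nat) (G : sgraph) (hG : cactus_class G n k) :
  (forall H : sgraph, cactus_class H n k -> pn G <= pn H) <->
  (forall C : subgraph G, C \in cycles G -> end_triangle C).
Proof.
have bound H : cactus_class H n k ->
    (n + 2 * k) ^ 2 + n <= 2 * pn H + 10 * k ?= iff [forall C in cycles H, end_triangle C].
  by case/and3P=> /leqif_pn + /eqP<- /eqP<-.
split=> [Gmin|allE]; last first.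
  move=> H hH; have [_ eqG] := bound G hG; have [leH _] := bound H hH.
  by move: eqG leH; rewrite (introT forall_inP allE) => /eqP->; lia.
apply/forall_inP; have [leG <-] := bound G hG; rewrite eqn_leq leG /=.
have [m en] : exists m, n = (2 * k + m).+1.
  case/and3P: hG => /cactus_size + /eqP<- /eqP<-.
  by move=> lt; exists (#|G| - (2 * #|cycles G|).+1); lia.
have hW : cactus_class (windmill k m) n k by rewrite en; apply: windmill_cactus.
have [_ eqW] := bound _ hW.
have allW : [forall C in cycles (windmill k m), end_triangle C].
  by apply/forall_inP; apply: windmill_end.
by rewrite allW in eqW; rewrite (eqP eqW); have := Gmin _ hW; lia.
Qed.
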